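(* There are absolute constants $C,c>0$ such that for every $n$-point metric space $(X,d)$ and every $\Delta>0$, with $\beta=C\log n$, there is a probability distribution $\mu$ over partitions of $X$ satisfying: (a) for all $\Pi\in\mathrm{supp}(\mu)$ and all $S\in\Pi$, $\mathrm{diam}(S)\le\Delta$; (b) for all $x,y\in X$, $\Pr_{\Pi\sim\mu}[\Pi(x)\neq\Pi(y)]\le \beta d(x,y)/\Delta$; (c) for every shortest path $P$ with $d(P)\le\Delta/\beta$ and every $t\ge1$, $\Pr_{\Pi\sim\mu}[Z_P>t]\le 2e^{-ct}$.
   Context: For a partition $\Pi$ of $X$ and $x\in X$, $\Pi(x)$ denotes the cluster of $\Pi$ containing $x$. A shortest path between $x_0,x_\ell\in X$ is a sequence $P=(x_0,x_1,\dots,x_\ell)$ of points of $X$ with $\sum_{i=1}^{\ell}d(x_{i-1},x_i)=d(x_0,x_\ell)$; its length is $d(P)=d(x_0,x_\ell)$. $P$ meets a set $S$ if $S\cap P\neq\emptyset$. The degree of separation is $Z_P(\Pi)=\#\{S\in\Pi: P \text{ meets } S\}$. *)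

(* Defs.v *)
From mathcomp Require Import all_boot.
From Stdlib Require Import Reals.
Set Implicit Arguments. Unset Strict Implicit.

Section Defs.
Variable T : finType.
Implicit Types (d : T -> T -> R).

Definition is_metric d : Prop :=
  (forall x y, (0 <= d x y)%R) /\
  (forall x y, d x y = 0%R <-> x = y) /\
  (forall x y, d x y = d y x) /\
  (forall x y z, (d x z <= d x y + d y z)%R).

Fixpoint walk_len d (x : T) (p : seq T) : R :=
  match p with
  | [::] => 0%R
  | y :: q => (d x y + walk_len d y q)%R
  end.

Definition shortest_path d (x0 : T) (p : seq T) : Prop :=
  walk_len d x0 p = d x0 (last x0 p).

Definition path_length d (x0 : T) (p : seq T) : R := d x0 (last x0 p).

Definition Zsep (x0 : T) (p : seq T) (Pi : {set {set T}}) : nat :=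
  #|[set S in Pi | has (fun x => x \in S) (x0 :: p)]|.

Definition diam_le d (S : {set T}) (D : R) : Prop :=
  forall x y, x \in S -> y \in S -> (d x y <= D)%R.

Definition total_weight (mu : {set {set T}} -> R) : R :=
  foldr Rplus 0%R (map mu (enum {: {set {set T}}})).

Definition prob (mu : {set {set T}} -> R) (E : {set {set T}} -> bool) : R :=
  foldr Rplus 0%R
    (map (fun Pi => if E Pi then mu Pi else 0%R) (enum {: {set {set T}}})).

Definition supp (mu : {set {set T}} -> R) (Pi : {set {set T}}) : Prop :=
  (0 < mu Pi)%R.

Definition distribution_on_partitions (mu : {set {set T}} -> R) : Prop :=
  (forall Pi, (0 <= mu Pi)%R) /\ total_weight mu = 1%R /\
  (forall Pi, supp mu Pi -> partition Pi [set: T]).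

Definition Rltb (a b : R) : bool := if Rlt_dec a b then true else false.

End Defs.

(* Main.v *)
(* Round the metric up to multiples of a fine grid, so that distances become
   natural numbers, and carve balls around all points, in any order, with
   independent geometric radii. The first ball that reaches the uncovered part
   of a set of diameter m swallows all of it with probability at least q ^ m by
   lack of memory, so the number of clusters meeting the set exceeds N with
   probability at most (1 - q ^ m) ^ N: pairs (with N = 1) give (b), and paths,
   whose diameter is their length, give (c). For (a) the process is conditioned
   on all radii being below Delta / 2, an event of probability at least 1 / 2
   when each radius exceeds that bound with probability 1 / (2 n). *)

Require Import Defs.
From HB Require Import structures.
From mathcomp Require Import all_boot.
From Stdlib Require Import Reals Lra Lia ZArith.
Set Implicit Arguments. Unset Strict Implicit. Unset Printing Implicit Defensive.

(** * Finite real sums and the truncated geometric law *)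

Fact Rplus_associative : associative Rplus.
Proof. by move=> x y z; rewrite Rplus_assoc. Qed.

HB.instance Definition _ :=
  Monoid.isComLaw.Build R 0%R Rplus Rplus_associative Rplus_comm Rplus_0_l.

Section RealSums.
Local Open Scope R_scope.
Implicit Type I : finType.

Lemma sumR_le I (F G : I -> R) :
  (forall i, F i <= G i) -> \big[Rplus/0]_i F i <= \big[Rplus/0]_i G i.
Proof.
move=> FG; elim/big_ind2: _ => //; first exact: Rle_refl.
by move=> *; exact: Rplus_le_compat.
Qed.

Lemma sumR_mull I (a : R) (F : I -> R) :
  a * \big[Rplus/0]_i F i = \big[Rplus/0]_i (a * F i).
Proof. by elim/big_rec2: _ => [|i y1 y2 _ <-]; ring. Qed.

Lemma sumR_eq0 I (F : I -> R) :
  (forall i, F i = 0) -> \big[Rplus/0]_i F i = 0.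
Proof. by move=> F0; rewrite big1. Qed.

Lemma foldr_sumR I (F : I -> R) :
  foldr Rplus 0 [seq F i | i <- enum I] = \big[Rplus/0]_i F i.
Proof. by rewrite foldrE big_image. Qed.

Lemma bernoulli_le (e : R) (n : nat) : 0 <= e <= 1 -> 1 - INR n * e <= (1 - e) ^ n.
Proof.
move=> e01; elim: n => [|n IH]; first by rewrite /=; lra.
rewrite S_INR /=; have : (1 - e) * (1 - INR n * e) <= (1 - e) * (1 - e) ^ n.
  by apply: Rmult_le_compat_l; lra.
have := pos_INR n; nra.
Qed.

Lemma pow_antitone (q : R) (i j : nat) : 0 <= q <= 1 -> (i <= j)%nat -> q ^ j <= q ^ i.
Proof.
move=> q01 /subnKC<-; elim: (j - i)%nat => [|k IH]; first by rewrite addn0; lra.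
rewrite addnS /=; have := pow_le q (i + k) (proj1 q01); nra.
Qed.

(* Truncated geometric law; the mass [q ^ K] of the radii [>= K] is dropped. *)
Definition geom (q : R) (k : nat) : R := q ^ k - q ^ k.+1.

Lemma geom_ge0 q k : 0 <= q <= 1 -> 0 <= geom q k.
Proof. by move=> q01; have := pow_antitone q01 (leqnSn k); rewrite /geom; lra. Qed.

Lemma sum_geom_lt (q : R) (K b : nat) :
  \big[Rplus/0]_(k < K) (if (k < b)%nat then geom q k else 0) = 1 - q ^ minn K b.
Proof.
elim: K => [|K IH]; first by rewrite big_ord0 min0n /=; ring.
rewrite big_ord_recr /= {}IH; case: (ltnP K b) => Kb; rewrite ?(minn_idPl (ltnW Kb)) ?(minn_idPr Kb).
  by rewrite (minn_idPl Kb) /geom /=; ring.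
by rewrite (minn_idPr (leqW Kb)); ring.
Qed.

Lemma sum_geom (q : R) (K : nat) : \big[Rplus/0]_(k < K) geom q k = 1 - q ^ K.
Proof.
have := sum_geom_lt q K K; rewrite minnn => <-.
by apply: eq_bigr => k _; rewrite ltn_ord.
Qed.

(** One carving step: [a] is the distance from the centre to the nearest uncovered point, [m] the
    diameter bound, [j.+1] the number of further clusters allowed. With p = 1 - q^m the sum is p^j
    (P[k < a + m] - q^m P[k < a]), where P[k < b] = 1 - q^min(K, b). *)
Lemma sum_geom_memoryless (q : R) (K a m j : nat) : 0 <= q <= 1 ->
  \big[Rplus/0]_(k < K) (geom q k *
    (if (k < a)%nat then (1 - q ^ m) ^ j.+1
     else if (k < a + m)%nat then (1 - q ^ m) ^ j else 0))
  <= (1 - q ^ m) ^ j.+1.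
Proof.
move=> q01; set p := 1 - q ^ m.
have qm1 : q ^ m <= 1 by have := pow_antitone q01 (leq0n m).
have qm0 : 0 <= q ^ m by apply: pow_le; lra.
have p0 : 0 <= p ^ j by apply: pow_le; rewrite /p; lra.
pose F b (k : 'I_K) := if (k < b)%nat then geom q k else 0.
have -> : \big[Rplus/0]_(k < K) (geom q k *
    (if (k < a)%nat then p ^ j.+1 else if (k < a + m)%nat then p ^ j else 0)) =
  p ^ j * (\big[Rplus/0]_k F (a + m)%nat k) +
  (- (p ^ j * q ^ m)) * (\big[Rplus/0]_k F a k).
  rewrite !sumR_mull -big_split; apply: eq_bigr => k _ /=; rewrite /F.
  case: (ltnP k a) => ka; last by case: ifP => _; ring.
  by rewrite (leq_trans ka (leq_addr _ _)) /p; ring.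
rewrite !sum_geom_lt.
(* Truncation at [K] only helps: min(K, a) + m >= min(K, a + m). *)
have le : q ^ (minn K a + m) <= q ^ minn K (a + m).
  apply: pow_antitone => //; rewrite addn_minl leq_min geq_minr andbT.
  by rewrite (leq_trans (geq_minl _ _)) ?leq_addr.
move: le; rewrite pow_add /= /p => le; rewrite -/p.
have : p ^ j * (1 - q ^ minn K (a + m) - q ^ m * (1 - q ^ minn K a)) <= p ^ j * p.
  by apply: Rmult_le_compat_l => //; rewrite /p; lra.
lra.
Qed.

End RealSums.

(** * Carving one ball out of the uncovered points *)

Section Carving.
Variable T : finType.
Implicit Types (A Pi : {set {set T}}) (B S : {set T}).

(** An empty remainder is not added, since a partition has no empty block. *)
Definition carve A B : {set {set T}} :=
  let C := B :\: cover A in if C == set0 then A else C |: A.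

Lemma cover_carve A B : cover (carve A B) = cover A :|: B.
Proof.
rewrite /carve; case: eqP => [/eqP|_].
  by rewrite setD_eq0 => /setUidPl.
rewrite /cover bigcup_setU big_set1 -/(cover A).
by apply/setP => x; rewrite !in_setU in_setD; case: (x \in cover A); rewrite ?orbT ?orbF.
Qed.

Lemma notin_new_cluster A B : B :\: cover A != set0 -> B :\: cover A \notin A.
Proof.
case/set0Pn => x xC; apply/negP => CA.
have : x \in cover A by apply/bigcupP; exists (B :\: cover A).
by apply/negP; case/setDP: xC.
Qed.

Lemma partition_carve A B :
  partition A (cover A) -> partition (carve A B) (cover (carve A B)).
Proof.
rewrite /carve; case: eqVneq => // C0 pA.
have [_ tA nA] := and3P pA.
rewrite /cover bigcup_setU big_set1 -/(cover A).
apply: partitionU1 => //.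
by rewrite disjoints_subset setDE subsetIr.
Qed.

Lemma Zsep_carve_hit (x0 : T) p A B :
  has (fun x => x \in B :\: cover A) (x0 :: p) ->
  Zsep x0 p (carve A B) = (Zsep x0 p A).+1.
Proof.
move=> hit; have C0 : B :\: cover A != set0.
  by case/hasP: hit => x _ xC; apply/set0Pn; exists x.
rewrite /Zsep /carve (negbTE C0).
have -> : [set S in (B :\: cover A) |: A | has (fun x => x \in S) (x0 :: p)] =
   (B :\: cover A) |: [set S in A | has (fun x => x \in S) (x0 :: p)].
  apply/setP => S; rewrite !in_set !in_set1; case: eqP => [->|//]; by rewrite hit.
by rewrite cardsU1 inE (negbTE (notin_new_cluster C0)).
Qed.

Lemma Zsep_carve_miss (x0 : T) p A B :
  ~~ has (fun x => x \in B :\: cover A) (x0 :: p) ->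
  Zsep x0 p (carve A B) = Zsep x0 p A.
Proof.
move=> miss; rewrite /Zsep /carve; case: eqP => // _.
apply: eq_card => S; rewrite !in_set !in_set1; case: eqP => [->|//].
by rewrite (negbTE miss) !andbF.
Qed.

(** Turns (b) into a tail bound with threshold 1 for the two-point sequence [x], [y]. *)
Lemma pblock_neq_Zsep A (x y : T) : partition A [set: T] ->
  pblock A x != pblock A y -> (1 < Zsep x [:: y] A)%nat.
Proof.
case/and3P => /eqP cA _ _ ne.
have cov z : z \in cover A by rewrite cA inE.
apply/card_gt1P; exists (pblock A x), (pblock A y).
by split; rewrite // inE pblock_mem //= mem_pblock cov ?orbT.
Qed.

End Carving.

(** * The mass of an event under random carving *)

Section Mass.
Variables (T : finType) (D : T -> T -> nat) (K : nat) (q : R).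
Hypothesis q01 : (0 <= q <= 1)%R.
Local Open Scope R_scope.
Implicit Types (A Pi : {set {set T}}) (E : {set {set T}} -> bool) (s : seq T).

Definition nball (v : T) (k : nat) : {set T} := [set y | (D v y <= k)%nat].

(* Unnormalised probability of [E] when the balls centred at [s] are carved
   after [A]; outcomes with a radius [>= K] are dropped, so the total is
   [(1 - q ^ K) ^ size s]. *)
Fixpoint mass s A E : R :=
  if s is v :: s' then
    \big[Rplus/0]_(k < K) (geom q k * mass s' (carve A (nball v k)) E)
  else if E A then 1 else 0.

Lemma mass_ge0 s A E : 0 <= mass s A E.
Proof.
elim: s A => [|v s IH] A /=; first by case: ifP; lra.
rewrite -[X in X <= _](@sumR_eq0 'I_K (fun=> 0)) //; apply: sumR_le => k.
by apply: Rmult_le_pos; [exact: geom_ge0 | exact: IH].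
Qed.

Lemma mass_mono s A E E' : (forall Pi, E Pi -> E' Pi) -> mass s A E <= mass s A E'.
Proof.
move=> EE'; elim: s A => [|v s IH] A /=.
  by case: ifP => [/EE'->|_]; first lra; case: ifP; lra.
apply: sumR_le => k; apply: Rmult_le_compat_l; [exact: geom_ge0 | exact: IH].
Qed.

Lemma mass_all s A : mass s A xpredT = (1 - q ^ K) ^ size s.
Proof.
elim: s A => [|v s IH] A //=.
rewrite -{1}sum_geom Rmult_comm sumR_mull; apply: eq_bigr => k _.
by rewrite IH Rmult_comm.
Qed.

Lemma mass_le1 s A E : mass s A E <= 1.
Proof.
apply: (Rle_trans _ _ _ (mass_mono s A (E' := xpredT) (fun _ _ => isT))).
rewrite mass_all -[X in _ <= X](pow1 (size s)); apply: pow_incr.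
have := pow_le q K (proj1 q01); have := pow_antitone q01 (leq0n K).
by rewrite /=; lra.
Qed.

(** Lets the law be defined by its point masses while events are estimated through the recursion of
    [mass]. *)
Lemma mass_sum s A E :
  \big[Rplus/0]_Pi (if E Pi then mass s A (pred1 Pi) else 0) = mass s A E.
Proof.
elim: s A => [|v s IH] A /=.
  rewrite (bigD1 A) //= eqxx big1 => [|Pi /negbTE nA]; first by rewrite Monoid.mulm1.
  by rewrite eq_sym nA; case: ifP.
transitivity (\big[Rplus/0]_Pi \big[Rplus/0]_(k < K)
    (geom q k * (if E Pi then mass s (carve A (nball v k)) (pred1 Pi) else 0))).
  by apply: eq_bigr => Pi _; case: ifP => // _; rewrite sumR_eq0 // => k; ring.
by rewrite exchange_big; apply: eq_bigr => k _; rewrite -sumR_mull IH.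
Qed.

(** Positive mass yields radii below [K] that produce [Pi] from [A]. Each centre lies in its own
    ball, so nothing stays uncovered once every uncovered point has served as a centre. *)
Lemma mass_supp s A Pi : (forall v, D v v = 0%nat) ->
  partition A (cover A) -> {subset ~: cover A <= s} -> 0 < mass s A (pred1 Pi) ->
  partition Pi [set: T] /\
  forall S, S \in Pi -> S \in A \/ exists v, exists2 k, (k < K)%nat & S \subset nball v k.
Proof.
move=> D0; elim: s A => [|v s IH] A pA sub /=.
  case: eqP => [<- _|]; last by move=> _; lra.
  have cA : cover A = [set: T].
    by apply/setP => x; rewrite inE; apply/negPn/negP => xA; have := sub x; rewrite inE xA => /(_ isT).
  by split; [rewrite -cA | move=> S; left].
move=> pos.
have [k posk] : exists k : 'I_K, 0 < mass s (carve A (nball v k)) (pred1 Pi).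
  case: (pickP (fun k : 'I_K => Rltb 0 (mass s (carve A (nball v k)) (pred1 Pi)))) => [k|none].
    by rewrite /Rltb; case: Rlt_dec => // h _; exists k.
  exfalso; move: pos; rewrite sumR_eq0; first by lra.
  move=> k; have := none k; rewrite /Rltb; case: Rlt_dec => // h _.
  have := mass_ge0 s (carve A (nball v k)) (pred1 Pi).
  move=> ge0; suff -> : mass s (carve A (nball v k)) (pred1 Pi) = 0 by ring.
  by lra.
have [||pPi cl] := IH _ _ _ posk; first exact: partition_carve.
  move=> x; rewrite cover_carve setCU inE => /andP[xA xB].
  have := sub x xA; rewrite inE => /orP[/eqP xv|//].
  by move: xB; rewrite xv !inE D0 leq0n.
split=> // S /cl[|]; last by right.
rewrite /carve; case: eqP => [_|_]; first by left.
rewrite in_setU1 => /orP[/eqP->|]; last by left.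
by right; exists v, k => //; exact: subsetDl.
Qed.

(** * Tail bound for the number of clusters meeting a set *)

Section Separation.
Variables (x0 : T) (p : seq T) (m : nat).
Hypothesis D_triangle : forall x y z, (D x z <= D x y + D y z)%nat.
Hypothesis D_le : {in x0 :: p &, forall x y, (D x y <= m)%nat}.

(** New clusters consist of uncovered points only, so the count is frozen once the whole path is
    covered. *)
Lemma mass_Zsep_covered s A N : {subset x0 :: p <= cover A} ->
  (Zsep x0 p A <= N)%nat -> mass s A (fun Pi => (N < Zsep x0 p Pi)%nat) = 0.
Proof.
elim: s A => [|v s IH] A sub le /=; first by rewrite ltnNge le.
rewrite sumR_eq0 // => k; rewrite IH; first by ring.
  by move=> x /sub xA; rewrite cover_carve inE xA.
rewrite Zsep_carve_miss //; apply/hasPn => x /sub xA.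
by rewrite inE xA.
Qed.

(* The first ball that reaches the uncovered part of the path, at distance [a],
   contains all of the path as soon as its radius is at least [a + m]. By
   lack of memory this fails with probability at most [1 - q ^ m]. *)
Lemma mass_Zsep s A N :
  mass s A (fun Pi => (N < Zsep x0 p Pi)%nat) <= (1 - q ^ m) ^ (N - Zsep x0 p A).
Proof.
have qm1 : q ^ m <= 1 by have := pow_antitone q01 (leq0n m).
elim: s A => [|v s IH] A.
  have [le|gt] := leqP (Zsep x0 p A) N.
    by rewrite /= ltnNge le; apply: pow_le; lra.
  by have /eqP-> : (N - Zsep x0 p A == 0)%nat; [rewrite subn_eq0 ltnW | exact: mass_le1].
(* If the count has reached [N], truncated subtraction makes the exponent 0 and the bound is 1. *)
have [le|lt] := leqP N (Zsep x0 p A).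
  by have /eqP-> : (N - Zsep x0 p A == 0)%nat; [rewrite subn_eq0 | exact: mass_le1].
have [/allP sub|] := boolP (all (fun x => x \in cover A) (x0 :: p)).
  by rewrite mass_Zsep_covered // ?(ltnW lt) //; apply: pow_le; lra.
case/allPn => z zp zA.
case: (arg_minnP (P := [pred x | (x \in x0 :: p) && (x \notin cover A)]) (D v) (i0 := z));
  first by rewrite /= zp.
move=> x1 /andP[x1p x1A] x1min; set a := D v x1.
move: lt; rewrite -subn_gt0 => lt; rewrite -(prednK lt).
apply: Rle_trans (sum_geom_memoryless K a m (N - Zsep x0 p A).-1 q01).
rewrite [X in X <= _]/=; apply: sumR_le => k.
apply: Rmult_le_compat_l; first exact: geom_ge0.
(* A radius below [a] leaves the count unchanged; one in [a, a + m) adds a cluster and lowers the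
   exponent by one; a larger one covers the path with count at most [N], so the event has mass 0. *)
case: ltnP => [ka|ak].
  rewrite (prednK lt) -(@Zsep_carve_miss _ x0 p A (nball v k)); first exact: IH.
  apply/hasPn => x xp; rewrite in_setD negb_and negbK.
  case: (boolP (x \in cover A)) => //= xA; rewrite inE -ltnNge.
  by apply: leq_trans ka _; apply: x1min; rewrite /= xp.
have hit : Zsep x0 p (carve A (nball v k)) = (Zsep x0 p A).+1.
  by apply: Zsep_carve_hit; apply/hasP; exists x1 => //; rewrite !inE x1A.
case: ltnP => [_|amk]; first by rewrite -subnS -hit; exact: IH.
rewrite mass_Zsep_covered; first exact: Rle_refl.
  move=> x xp; rewrite cover_carve !inE; apply/orP; right.
  apply: leq_trans (D_triangle v x1 x) _; apply: leq_trans amk.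
  by rewrite leq_add2l; apply: D_le.
by rewrite hit -subn_gt0.
Qed.

End Separation.
End Mass.

(** * Normalising the mass to a probability distribution *)

Section Normalisation.
Variable T : finType.
Local Open Scope R_scope.
Implicit Types (mu : {set {set T}} -> R) (E : {set {set T}} -> bool).

Lemma prob_sumR mu E : prob mu E = \big[Rplus/0]_Pi (if E Pi then mu Pi else 0).
Proof. exact: foldr_sumR. Qed.

Lemma prob_le_supp mu E E' : (forall Pi, 0 <= mu Pi) ->
  (forall Pi, supp mu Pi -> E Pi -> E' Pi) -> prob mu E <= prob mu E'.
Proof.
move=> mu0 EE'; rewrite !prob_sumR; apply: sumR_le => Pi.
have [mu_pos|mu_eq0] : 0 < mu Pi \/ mu Pi = 0 by have := mu0 Pi; lra.
  by case: ifP => [/(EE' _ mu_pos)->|_]; [lra | case: ifP; lra].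
by rewrite mu_eq0; case: ifP; case: ifP; lra.
Qed.

(** Conditioning on all radii being below [K] divides the mass by (1 - q^K)^n >= 1/2, whence the
    factor 2 in the tail bound. *)
Lemma carving_distribution (D : T -> T -> nat) (K : nat) (q : R) :
  0 <= q <= 1 -> 1 / 2 <= (1 - q ^ K) ^ #|T| ->
  (forall v, D v v = 0%nat) -> (forall x y z, (D x z <= D x y + D y z)%nat) ->
  exists mu : {set {set T}} -> R,
    distribution_on_partitions mu /\
    (forall Pi, supp mu Pi -> forall S, S \in Pi ->
       exists v, exists2 k, (k < K)%nat & S \subset nball D v k) /\
    (forall x0 p m N, {in x0 :: p &, forall x y, (D x y <= m)%nat} ->
       prob mu (fun Pi => (N < Zsep x0 p Pi)%nat) <= 2 * (1 - q ^ m) ^ N).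
Proof.
move=> q01 W_ge D0 D_triangle; set W := _ ^ #|T| in W_ge.
have invW0 : 0 < / W by apply: Rinv_0_lt_compat; lra.
have invW2 : / W <= 2 by rewrite -(Rinv_inv 2); apply: Rinv_le_contravar; lra.
pose mu Pi := / W * mass D K q (enum T) set0 (pred1 Pi).
have muE E : prob mu E = / W * mass D K q (enum T) set0 E.
  rewrite prob_sumR -mass_sum sumR_mull; apply: eq_bigr => Pi _.
  by case: ifP => // _; ring.
have mass_pos Pi : supp mu Pi -> 0 < mass D K q (enum T) set0 (pred1 Pi).
  by rewrite /supp /mu => ?; apply: (Rmult_lt_reg_l (/ W)); rewrite ?Rmult_0_r.
have part0 : partition set0 (cover (set0 : {set {set T}})).
  by rewrite /partition eqxx inE andbT; apply/trivIsetP => A B; rewrite inE.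
have sub0 : {subset ~: cover (set0 : {set {set T}}) <= enum T}.
  by move=> x _; rewrite mem_enum.
exists mu; split; last split.
- split; [|split].
  + by move=> Pi; apply: Rmult_le_pos; [lra | exact: mass_ge0].
  + have -> : total_weight mu = prob mu xpredT by [].
    by rewrite muE mass_all -cardE Rinv_l //; lra.
  + by move=> Pi /mass_pos/(mass_supp q01 D0 part0 sub0)[].
- move=> Pi /mass_pos/(mass_supp q01 D0 part0 sub0)[_ cl] S /cl[|//].
  by rewrite inE.
- move=> x0 p m N D_le; rewrite muE.
  have := mass_Zsep K q01 D_triangle D_le (enum T) set0 N.
  have -> : Zsep x0 p (set0 : {set {set T}}) = 0%nat.
    by apply/eqP; rewrite cards_eq0; apply/eqP/setP => S; rewrite !inE.
  by rewrite subn0; apply: Rmult_le_compat; [lra | exact: mass_ge0 | lra].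
Qed.

End Normalisation.

(** * Integer rounding and elementary bounds on ln and exp *)

Section NatCeil.
Local Open Scope R_scope.

(** As [up] is the floor plus one, 1 - up(-r) is the ceiling of r; negative values are sent to 0. *)
Definition natceil (r : R) : nat := Z.to_nat (1 - up (- r)).

Lemma natceil_le (r : R) (n : nat) : (natceil r <= n)%nat <-> r <= INR n.
Proof.
have [up_gt up_le] := archimed (- r); rewrite /natceil INR_IZR_INZ; split.
  move/leP => le; apply: (Rle_trans _ (IZR (1 - up (- r)))); last by apply: IZR_le; lia.
  by rewrite minus_IZR; lra.
move=> le; have : (- Z.of_nat n < up (- r))%Z by apply: lt_IZR; rewrite opp_IZR; lra.
by move=> ?; apply/leP; lia.
Qed.

Lemma natceil_ge (r : R) : r <= INR (natceil r).
Proof. by apply/natceil_le. Qed.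

Lemma natceil_leD1 (r : R) : 0 <= r -> INR (natceil r) <= r + 1.
Proof.
move=> r0; have [up_gt up_le] := archimed (- r).
have : (up (- r) < 2)%Z by apply: lt_IZR; lra.
move=> lt2; rewrite /natceil INR_IZR_INZ Z2Nat.id; last by lia.
by rewrite minus_IZR; lra.
Qed.

Lemma natceil_le_double (r : R) : r = 0 \/ 1 <= r -> INR (natceil r) <= 2 * r.
Proof.
case=> [->|r1]; last by have := natceil_leD1 (r := r); lra.
have : (natceil 0 <= 0)%nat by apply/natceil_le => /=; lra.
by rewrite leqn0 => /eqP->; rewrite /=; lra.
Qed.

Lemma natfloor_exists (t : R) : 0 <= t -> exists N : nat, INR N <= t < INR N + 1.
Proof.
move=> t0; have [up_gt up_le] := archimed t.
have : (0 < up t)%Z by apply: lt_IZR; lra.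
move=> up0; exists (Z.to_nat (up t - 1)).
by rewrite INR_IZR_INZ Z2Nat.id; [rewrite minus_IZR; lra | lia].
Qed.

Lemma ln_le_mono (x y : R) : 0 < x -> x <= y -> ln x <= ln y.
Proof.
by move=> x0 [xy|->]; [left; exact: ln_increasing | exact: Rle_refl].
Qed.

Lemma exp_le_mono (x y : R) : x <= y -> exp x <= exp y.
Proof. by move=> [xy|->]; [left; exact: exp_increasing | exact: Rle_refl]. Qed.

Lemma exp_INR_mul (x : R) (n : nat) : exp (INR n * x) = exp x ^ n.
Proof.
elim: n => [|n IH]; first by rewrite /= Rmult_0_l exp_0.
by rewrite S_INR Rmult_plus_distr_r Rmult_1_l exp_plus IH /= Rmult_comm.
Qed.

End NatCeil.

(** * Diameter of a walk, choice of the grid, and comparison of logarithms *)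

Section Metric.
Variables (T : finType) (d : T -> T -> R).
Hypothesis d_metric : is_metric d.
Local Open Scope R_scope.

Let d_ge0 x y : 0 <= d x y. Proof. by case: d_metric. Qed.
Let d_refl x : d x x = 0.
Proof. by case: d_metric => _ [/(_ x x)[_ ->]]. Qed.
Let d_sym x y : d x y = d y x. Proof. by case: d_metric => _ [_ []]. Qed.
Let d_triangle x y z : d x z <= d x y + d y z.
Proof. by case: d_metric => _ [_ []]. Qed.

Lemma dist_gt0 x y : x != y -> 0 < d x y.
Proof.
move=> /eqP xy; have := d_ge0 x y; case: d_metric => _ [/(_ x y) d0 _].
by case: (Req_dec (d x y) 0) => [/d0//|]; lra.
Qed.

Lemma walk_len_ge0 x p : 0 <= walk_len d x p.
Proof. by elim: p x => [|y p IH] x /=; [lra | have := IH y; have := d_ge0 x y; lra]. Qed.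

Lemma dist_head_walk x p y : y \in x :: p -> d x y <= walk_len d x p.
Proof.
elim: p x => [|z p IH] x; first by rewrite inE => /eqP-> /=; rewrite d_refl; lra.
rewrite in_cons => /orP[/eqP->|/IH]; first by rewrite d_refl; exact: walk_len_ge0.
by rewrite /=; have := d_triangle x z y; lra.
Qed.

Lemma dist_walk x p : {in x :: p &, forall y z, d y z <= walk_len d x p}.
Proof.
elim: p x => [|a p IH] x y z.
  by rewrite !inE => /eqP-> /eqP->; rewrite d_refl /=; lra.
rewrite in_cons => /orP[/eqP-> |yp]; first exact: dist_head_walk.
rewrite in_cons => /orP[/eqP->|zp].
  by rewrite d_sym; apply: dist_head_walk; rewrite in_cons yp orbT.
by have := IH a y z yp zp; have := d_ge0 x a; rewrite /=; lra.
Qed.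

(** Distinct points are at least one grid unit Delta / (2K) apart, so rounding up at most doubles a
    distance. *)
Lemma fine_grid (Delta : R) : exists2 K : nat, (0 < K)%nat &
  forall x y, x != y -> Delta <= 2 * INR K * d x y.
Proof.
(* Diagonal pairs divide by 0; whatever their value, they can only enlarge the maximum. *)
pose F (xy : T * T) := natceil (Delta / (2 * d xy.1 xy.2)).
exists (\max_xy F xy).+1 => // x y /dist_gt0 dxy.
have : (F (x, y) <= (\max_xy F xy).+1)%nat by apply: leqW; apply: leq_bigmax.
move=> /natceil_le le; have -> : Delta = Delta / (2 * d x y) * (2 * d x y).
  by field; lra.
rewrite (_ : 2 * _ * _ = INR (\max_xy F xy).+1 * (2 * d x y)); last by ring.
by apply: Rmult_le_compat_r => //; lra.
Qed.

(** The radii decay at a rate set by ln(2n), whereas [beta] has ln n. Two distinct points force n >=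
    2, hence ln(2n) <= 2 ln n; for x = y both sides vanish. *)
Lemma ln_double_card x y :
  ln (2 * INR #|T|) * d x y <= 2 * ln (INR #|T|) * d x y.
Proof.
have [->|xy] := eqVneq x y; first by rewrite d_refl; lra.
apply: Rmult_le_compat_r; first exact: d_ge0.
have n2 : 2 <= INR #|T| by apply: (le_INR 2); apply/leP/card_gt1P; exists x, y.
rewrite ln_mult; try lra.
suff : ln 2 <= ln (INR #|T|) by lra.
by apply: ln_le_mono; lra.
Qed.

End Metric.

(* Includes the junk case [n = 0], where [ln 0 = 0]. *)
Lemma ln_double_INR (n : nat) :
  (0 <= ln (2 * INR n) /\ INR n * exp (- ln (2 * INR n)) <= 1 / 2)%R.
Proof.
case: n => [|n].
  have -> : ln (2 * INR 0) = 0%R.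
    by rewrite Rmult_0_r; unfold ln; case: (Rlt_dec 0 0) => // h; case: (Rlt_irrefl 0 h).
  by split; rewrite /=; lra.
have n1 : (1 <= INR n.+1)%R by apply: (le_INR 1); lia.
split; first by rewrite -ln_1; apply: ln_le_mono; lra.
by rewrite exp_Ropp exp_ln; [right; field | ]; lra.
Qed.

(** * Choice of constants and proof of the three properties *)

Theorem theorem2 :
  exists C c : R, (0 < C)%R /\ (0 < c)%R /\
  forall (T : finType) (d : T -> T -> R) (Delta : R),
    is_metric d -> (0 < Delta)%R ->
    let beta := (C * ln (INR #|T|))%R in
    exists mu : {set {set T}} -> R,
      distribution_on_partitions mu /\
      (* (a) *)
      (forall Pi, supp mu Pi -> forall S, S \in Pi -> diam_le d S Delta) /\
      (* (b) *)
      (forall x y : T,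
         (prob mu (fun Pi => pblock Pi x != pblock Pi y)
            <= beta * d x y / Delta)%R) /\
      (* (c) *)
      (forall (x0 : T) (p : seq T) (t : R),
         shortest_path d x0 p ->
         (path_length d x0 p <= Delta / beta)%R ->
         (1 <= t)%R ->
         (prob mu (fun Pi => Rltb t (INR (Zsep x0 p Pi)))
            <= 2 * exp (- (c * t)))%R).
Proof.
(* 16 is a product of four factors 2: conditioning, rounding, radius Delta / 2, and ln(2n) <= 2 ln
   n. *)
exists 16%R, (1 / 4)%R; split; [lra | split; [lra |]].
move=> T d Delta d_metric Delta0 beta.
have [d_ge0 [d_eq0 [d_sym d_triangle]]] := d_metric.
have d_refl x : d x x = 0%R by apply/d_eq0.
have [K K0 grid] := fine_grid d_metric Delta.
have K_pos : (0 < INR K)%R by apply: lt_0_INR; apply/ltP.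
have [L0 Lhalf] := ln_double_INR #|T|; set L := ln _ in L0 Lhalf.
pose q := exp (- (L / INR K)).
have LK0 : (0 <= L / INR K)%R by apply: Rle_mult_inv_pos.
have q01 : (0 <= q <= 1)%R.
  by split; [left; exact: exp_pos | rewrite -exp_0; apply: exp_le_mono; lra].
have qK : (q ^ K = exp (- L))%R by rewrite -exp_INR_mul; congr exp; field; lra.
have W_ge : (1 / 2 <= (1 - q ^ K) ^ #|T|)%R.
  apply: Rle_trans (bernoulli_le _ _); rewrite qK; first by lra.
  by split; [left; exact: exp_pos | rewrite -exp_0; apply: exp_le_mono; lra].
(* Rescaling that makes Delta / 2 equal to [K] grid units. *)
pose g r := (2 * INR K * r / Delta)%R.
have g_le r s : (r <= s -> g r <= g s)%R.
  by move=> rs; rewrite /g /Rdiv; apply: Rmult_le_compat_r;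
     [left; exact: Rinv_0_lt_compat | apply: Rmult_le_compat_l; lra].
pose D x y := natceil (g (d x y)).
have D0 v : D v v = 0%nat.
  by apply/eqP; rewrite -leqn0; apply/natceil_le; rewrite d_refl /g /=; lra.
have D_triangle x y z : (D x z <= D x y + D y z)%nat.
  apply/natceil_le; rewrite plus_INR.
  apply: Rle_trans (g_le _ _ (d_triangle x y z)) _.
  rewrite (_ : g _ = g (d x y) + g (d y z))%R; last by rewrite /g; field; lra.
  by apply: Rplus_le_compat; exact: natceil_ge.
have D_double x y : (INR (D x y) <= 2 * g (d x y))%R.
  apply: natceil_le_double; have [->|/grid le] := eqVneq x y.
    by left; rewrite d_refl /g; lra.
  right; apply: (Rmult_le_reg_r Delta) => //; rewrite /g.
  by rewrite (_ : _ / _ * _ = 2 * INR K * d x y)%R; [lra | field; lra].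
(* Serves both (b) and (c); it rests on 1 - e^(-u) <= u with u = D(x, y) L / K. *)
have cut x y : (2 * (1 - q ^ D x y) <= beta * d x y / Delta)%R.
  have qD : (1 - INR (D x y) * (L / INR K) <= q ^ D x y)%R.
    rewrite -exp_INR_mul; have := exp_ineq1_le (INR (D x y) * - (L / INR K)); lra.
  have : (INR (D x y) * (L / INR K) <= 2 * g (d x y) * (L / INR K))%R.
    exact: Rmult_le_compat_r.
  rewrite (_ : 2 * g _ * _ = 4 * (L * d x y) / Delta)%R; last by rewrite /g; field; lra.
  have : (4 * (L * d x y) / Delta <= 4 * (2 * ln (INR #|T|) * d x y) / Delta)%R.
    apply: Rmult_le_compat_r; first by left; exact: Rinv_0_lt_compat.
    by have := ln_double_card d_metric x y; rewrite -/L; lra.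
  by rewrite /beta /Rdiv; lra.
have [mu [mu_dist [mu_supp mu_Z]]] := carving_distribution q01 W_ge D0 D_triangle.
have [mu0 [_ mu_part]] := mu_dist.
exists mu; split=> //; split; [|split].
- move=> Pi /mu_supp cl S /cl[v [k kK /subsetP sub]] x y /sub xv /sub yv.
  have near z : z \in nball D v k -> (d v z <= Delta / 2)%R.
    rewrite inE => /leq_trans/(_ (ltnW kK))/natceil_le; rewrite /g => le.
    apply: (Rmult_le_reg_l (2 * INR K / Delta)).
      by apply: Rdiv_lt_0_compat; lra.
    rewrite (_ : _ * (Delta / 2) = INR K)%R; last by field; lra.
    by rewrite (_ : _ * d v z = 2 * INR K * d v z / Delta)%R //; field; lra.
  have := d_triangle x v y; rewrite (d_sym x v).
  by have := near x xv; have := near y yv; lra.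
- move=> x y; apply: Rle_trans (cut x y).
  apply: (Rle_trans _ (prob mu (fun Pi => (1 < Zsep x [:: y] Pi)%nat))).
    by apply: prob_le_supp => // Pi /mu_part; exact: pblock_neq_Zsep.
  rewrite -[X in (_ <= 2 * X)%R]pow_1; apply: mu_Z => u w.
  have D_sym : D y x = D x y by rewrite /D d_sym.
  by rewrite !inE => /orP[]/eqP-> /orP[]/eqP->; rewrite ?D0 ?D_sym ?leq0n.
- move=> x0 p t sp short t1.
  (* [N] is the floor of t; as N >= 1, N >= (N + 1) / 2 > t / 2. *)
  have [N [Nt tN]] := @natfloor_exists t ltac:(lra).
  have N1 : (1 <= INR N)%R.
    by apply: (le_INR 1); apply/leP; case: N Nt tN => //=; lra.
  apply: (Rle_trans _ (prob mu (fun Pi => (N < Zsep x0 p Pi)%nat))).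
    apply: prob_le_supp => // Pi _; rewrite /Rltb; case: Rlt_dec => // tZ _.
    by apply/ltP; apply: INR_lt; lra.
  pose m := D x0 (last x0 p).
  apply: Rle_trans (mu_Z x0 p m N _) _.
    move=> x y xp yp; apply/natceil_le; apply: Rle_trans (natceil_ge _).
    by apply: g_le; rewrite -sp; exact: dist_walk.
  apply: Rmult_le_compat_l; first by lra.
  have p_le : (1 - q ^ m <= 1 / 2)%R.
    have := cut x0 (last x0 p); rewrite -/m; move: short; rewrite /path_length => short.
    have -> : (1 / 2 = 1 / 2 * 1)%R by ring.
    suff : (beta * d x0 (last x0 p) / Delta <= 1)%R by lra.
    (* For n <= 1 [beta] is 0 and the bound Delta / beta carries no information, but the left side
       is then at most 0. *)
    have [beta0|beta0] := Rle_lt_dec beta 0.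
      have := d_ge0 x0 (last x0 p) => ge0.
      have : (0 <= - beta * d x0 (last x0 p) / Delta)%R.
        by apply: Rle_mult_inv_pos => //; nra.
      by rewrite /Rdiv; lra.
    apply: (Rmult_le_reg_r Delta) => //.
    rewrite (_ : _ / _ * _ = d x0 (last x0 p) * beta)%R; last by field; lra.
    apply: Rle_trans (Rmult_le_compat_r beta _ _ _ short) _; first by lra.
    by right; field; lra.
  have p_ge0 : (0 <= 1 - q ^ m)%R by have := pow_antitone q01 (leq0n m) => /=; lra.
  (* 1/2 <= e^(-1/2), and N > t / 2 turns e^(-N/2) into the rate 1/4. *)
  apply: (Rle_trans _ (exp (- (1 / 2)) ^ N)).
    by apply: pow_incr; have := exp_ineq1_le (- (1 / 2)); lra.
  by rewrite -exp_INR_mul; apply: exp_le_mono; lra.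
Qed.
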